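(* Let $\mathbb{K}$ be an algebraically closed field of characteristic not $2$ and $d\ge0$ an integer. In each case below, let $u,u^*,v$ (those that occur) be scalars in $\mathbb{K}$ such that $\theta_i\ne\theta_j$, $\theta_i^*\ne\theta_j^*$ for $0\le i<j\le d$ and $\varphi_i\ne0$, $\phi_i\ne0$ for $1\le i\le d$. Then the Leonard pair corresponding to the given parameter array satisfies the given Askey-Wilson relations. - Racah: for $\theta_i=(i+u)(i+u+1)$, $\theta_i^*=(i+u^* )(i+u^*+1)$, $\varphi_i=i(i-d-1)(i+u+u^*-v)(i+u+u^*+d+1+v)$, $\phi_i=i(i-d-1)(i-u+u^*+v)(i-u+u^*-d-1-v)$: $$AW\big(2,2,2,0,0,\,-2u^2-2u^{*2}-2v^2-2(d+1)(u+u^*+v)-2d^2-4d,$$ $$2u(u+d+1)(v-u^* )(v+u^*+d+1),\ 2u^*(u^*+d+1)(v-u)(v+u+d+1)\big).$$ - Hahn: for $\theta_i=i+v-\frac d2$, $\theta_i^*=(i+u^* )(i+u^*+1)$, $\varphi_i=i(i-d-1)(i+u^*+2v)$, $\phi_i=-i(i-d-1)(i+u^*-2v)$: $$AW\big(2,0,2,1,0,0,\,-(u^*+1)(u^*+d)-2v^2-\tfrac{d^2}2,\,-4u^*(u^*+d+1)v\big).$$ - Dual Hahn: for $\theta_i=(i+u)(i+u+1)$, $\theta_i^*=i+v-\frac d2$, $\varphi_i=i(i-d-1)(i+u+2v)$, $\phi_i=i(i-d-1)(i-u+2v-d-1)$: $$AW\big(2,2,0,0,1,0,\,-4u(u+d+1)v,\,-(u+1)(u+d)-2v^2-\tfrac{d^2}2\big).$$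 - Krawtchouk: for $\theta_i=i-\frac d2$, $\theta_i^*=i-\frac d2$, $\varphi_i=v\,i(i-d-1)$, $\phi_i=(v-1)\,i(i-d-1)$: $$AW\big(2,0,0,1,1,2v-1,0,0\big).$$ - Bannai-Ito, $d$ even: for $\theta_i=(-1)^i(i+u-\frac d2)$, $\theta_i^*=(-1)^i(i+u^*-\frac d2)$, with $\varphi_i=-i(i+u+u^*+v-\frac{d+1}2)$ and $\phi_i=i(i-u+u^*-v-\frac{d+1}2)$ for $i$ even, $\varphi_i=-(i-d-1)(i+u+u^*-v-\frac{d+1}2)$ and $\phi_i=(i-d-1)(i-u+u^*+v-\frac{d+1}2)$ for $i$ odd: $$AW\big(-2,0,0,1,1,\,4uu^*-2(d+1)v,\,2uv-(d+1)u^*,\,2u^*v-(d+1)u\big).$$ - Bannai-Ito, $d$ odd: for $\theta_i=(-1)^i(i+u-\frac d2)$, $\theta_i^*=(-1)^i(i+u^*-\frac d2)$, with $\varphi_i=\phi_i=-i(i-d-1)$ for $i$ even, $\varphi_i=v^2-(i+u+u^*-\frac{d+1}2)^2$ and $\phi_i=v^2-(i-u+u^*-\frac{d+1}2)^2$ for $i$ odd: $$AW\big(-2,0,0,1,1,\,-2u^2-2u^{*2}+2v^2+\tfrac{(d+1)^2}2,\,-u^2+u^{*2}-v^2+\tfrac{(d+1)^2}4,\,u^2-u^{*2}-v^2+\tfrac{(d+1)^2}4\big).$$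
   Context: The displayed sequences $(\theta_0,\ldots,\theta_d;\theta_0^*,\ldots,\theta_d^*;\varphi_1,\ldots,\varphi_d;\phi_1,\ldots,\phi_d)$ are parameter arrays of diameter $d$ in Terwilliger's sense. The Leonard pair corresponding to such an array is, up to isomorphism (simultaneous conjugation), the pair $(A,A^* )$ of linear transformations of a $(d+1)$-dimensional $\mathbb{K}$-vector space whose matrices in some basis are: $A$ is lower bidiagonal with diagonal entries $\theta_0,\theta_1,\ldots,\theta_d$ and all subdiagonal entries equal to $1$; $A^*$ is upper bidiagonal with diagonal entries $\theta_0^*,\theta_1^*,\ldots,\theta_d^*$ and superdiagonal entries $\varphi_1,\ldots,\varphi_d$. A Leonard pair on $V$ is an ordered pair $(A,A^* )$ of linear transformations of $V$ such that there is a basis in which $A^*$ is diagonal and $A$ irreducible tridiagonal (tridiagonal with all super- and subdiagonal entries nonzero), and a basis in which $A$ is diagonal and $A^*$ irreducible tridiagonal. ($A^*$ is not an adjoint of $A$; $u^*$ is just a scalar and $u^{*2}=(u^* )^2$.) $AW(\beta,\gamma,\gamma^*,\varrho,\varrho^*,\omega,\eta,\eta^* )$ denotes the pair of Askey-Wilson relations $$A^2A^*-\beta AA^*A+A^*A^2-\gamma(AA^*+A^*A)-\varrho A^*=\gamma^*A^2+\omega A+\eta I,$$ $$A^{*2}A-\beta A^*AA^*+AA^{*2}-\gamma^*(A^*A+AA^* )-\varrho^*A=\gamma A^{*2}+\omega A^*+\eta^*I.$$ *)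

(* Defs.v *)
From mathcomp Require Import all_boot all_order all_algebra.

Set Implicit Arguments.
Unset Strict Implicit.
Unset Printing Implicit Defensive.

Import GRing.Theory.

Local Open Scope ring_scope.

(* The sequences (theta_i; theta*_i; varphi_i; phi_i), as functions of the
   index.  In diameter d only the values of [th] and [ths] at 0, ..., d and
   those of [vphi] and [phi] at 1, ..., d are meaningful. *)
Record array (K : Type) := Array {
  th : nat -> K;
  ths : nat -> K;
  vphi : nat -> K;
  phi : nat -> K
}.

Definition nondegenerate_array (K : fieldType) (d : nat) (p : array K) : Prop :=
  [/\ forall i j : nat, (i < j <= d)%N -> th p i != th p j,
      forall i j : nat, (i < j <= d)%N -> ths p i != ths p j,
      forall i : nat, (1 <= i <= d)%N -> vphi p i != 0
    & forall i : nat, (1 <= i <= d)%N -> phi p i != 0].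

Definition split_mx (K : fieldType) (d : nat) (p : array K) : 'M[K]_d.+1 :=
  \matrix_(i, j) (if i == j then th p i
                  else if i == j.+1 :> nat then 1 else 0).

(* The entry in row i - 1 and column i is varphi_i. *)
Definition split_mxs (K : fieldType) (d : nat) (p : array K) : 'M[K]_d.+1 :=
  \matrix_(i, j) (if i == j then ths p i
                  else if j == i.+1 :> nat then vphi p j else 0).

(* Column convention: the coordinates of [f b_j] form the j-th column of M
   (the transpose of the row-vector convention of [mxof]). *)
Definition represents (K : fieldType) (V : vectType K) (n : nat)
    (b : n.-tuple V) (f : 'End(V)) (M : 'M[K]_n) : Prop :=
  forall j : 'I_n, f (tnth b j) = \sum_i M i j *: tnth b i.

(* (A, As) is the Leonard pair corresponding to p, for a nondegenerate
   parameter array p.  That such a pair is a Leonard pair is Terwilliger's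
   theorem; it is neither assumed nor asserted here.  The existence of b forces
   \dim {:V} = d + 1. *)
Definition corresponding_pair (K : fieldType) (d : nat) (p : array K)
    (V : vectType K) (A As : 'End(V)) : Prop :=
  exists b : d.+1.-tuple V,
    [/\ basis_of fullv b,
        represents b A (split_mx d p)
      & represents b As (split_mxs d p)].

(* Products are written with [\o] because 'End(V) has no canonical ring
   structure for an arbitrary (possibly zero) vectType V. *)
Definition AW (K : fieldType) (V : vectType K)
    (beta gam gams rho rhos omega eta etas : K) (A As : 'End(V)) : Prop :=
  (A \o A \o As)%VF - beta *: (A \o As \o A)%VF + (As \o A \o A)%VF
    - gam *: ((A \o As)%VF + (As \o A)%VF) - rho *: As
    = gams *: (A \o A)%VF + omega *: A + eta *: \1%VF
  /\
  (As \o As \o A)%VF - beta *: (As \o A \o As)%VF + (A \o As \o As)%VF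
    - gams *: ((As \o A)%VF + (A \o As)%VF) - rhos *: A
    = gam *: (As \o As)%VF + omega *: As + etas *: \1%VF.

Section Families.

Variables (K : fieldType) (d : nat).

Local Notation D := (d%:R : K).

Definition racah (u us v : K) : array K := {|
  th := fun i => (i%:R + u) * (i%:R + u + 1);
  ths := fun i => (i%:R + us) * (i%:R + us + 1);
  vphi := fun i => i%:R * (i%:R - D - 1) * (i%:R + u + us - v)
                     * (i%:R + u + us + D + 1 + v);
  phi := fun i => i%:R * (i%:R - D - 1) * (i%:R - u + us + v)
                    * (i%:R - u + us - D - 1 - v)
|}.

Definition hahn (us v : K) : array K := {|
  th := fun i => i%:R + v - D / 2%:R;
  ths := fun i => (i%:R + us) * (i%:R + us + 1);
  vphi := fun i => i%:R * (i%:R - D - 1) * (i%:R + us + 2%:R * v);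
  phi := fun i => - (i%:R * (i%:R - D - 1) * (i%:R + us - 2%:R * v))
|}.

Definition dual_hahn (u v : K) : array K := {|
  th := fun i => (i%:R + u) * (i%:R + u + 1);
  ths := fun i => i%:R + v - D / 2%:R;
  vphi := fun i => i%:R * (i%:R - D - 1) * (i%:R + u + 2%:R * v);
  phi := fun i => i%:R * (i%:R - D - 1) * (i%:R - u + 2%:R * v - D - 1)
|}.

Definition krawtchouk (v : K) : array K := {|
  th := fun i => i%:R - D / 2%:R;
  ths := fun i => i%:R - D / 2%:R;
  vphi := fun i => v * i%:R * (i%:R - D - 1);
  phi := fun i => (v - 1) * i%:R * (i%:R - D - 1)
|}.

Definition bannai_ito_even (u us v : K) : array K := {|
  th := fun i => (-1) ^+ i * (i%:R + u - D / 2%:R);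
  ths := fun i => (-1) ^+ i * (i%:R + us - D / 2%:R);
  vphi := fun i =>
    if odd i then - ((i%:R - D - 1) * (i%:R + u + us - v - (D + 1) / 2%:R))
    else - (i%:R * (i%:R + u + us + v - (D + 1) / 2%:R));
  phi := fun i =>
    if odd i then (i%:R - D - 1) * (i%:R - u + us + v - (D + 1) / 2%:R)
    else i%:R * (i%:R - u + us - v - (D + 1) / 2%:R)
|}.

Definition bannai_ito_odd (u us v : K) : array K := {|
  th := fun i => (-1) ^+ i * (i%:R + u - D / 2%:R);
  ths := fun i => (-1) ^+ i * (i%:R + us - D / 2%:R);
  vphi := fun i =>
    if odd i then v ^+ 2 - (i%:R + u + us - (D + 1) / 2%:R) ^+ 2
    else - (i%:R * (i%:R - D - 1));
  phi := fun i =>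
    if odd i then v ^+ 2 - (i%:R - u + us - (D + 1) / 2%:R) ^+ 2
    else - (i%:R * (i%:R - D - 1))
|}.

End Families.

(* Main.v *)
(* On the split basis, extended by zero to all indices, both relations reduce to
   scalar identities between theta_j, theta*_j, varphi_j with j ranging over the
   naturals, which are rational identities in j, d and the parameters (for each
   parity of j in the Bannai-Ito cases). *)

Require Import Defs.
From mathcomp Require Import all_boot all_order all_algebra.
From mathcomp Require Import ring.

Set Implicit Arguments.
Unset Strict Implicit.

Import GRing.Theory.
Local Open Scope ring_scope.

(** The index [k] may lie outside the range of summation, where both sides vanish because [e k = 0].
    The last column of [split_mx] needs this, with [k = d.+1]. *)
Lemma sum_kronecker (K : fieldType) (V : lmodType K) (n k : nat)
    (a : nat -> K) (e : nat -> V) :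
  (forall j, (n <= j)%N -> e j = 0) ->
  \sum_(i < n) (if i == k :> nat then a i else 0) *: e i = a k *: e k.
Proof.
move=> e0; have [lt_kn | le_nk] := ltnP k n.
  rewrite (bigD1 (Ordinal lt_kn)) //= eqxx big1 ?addr0 // => i.
  by rewrite -val_eqE /= => /negbTE->; rewrite scale0r.
rewrite e0 // scaler0 big1 // => i _.
by rewrite (ltn_eqF (leq_trans (ltn_ord i) le_nk)) scale0r.
Qed.

(* Since [vphi] vanishes at 0 and at d + 1, the split basis extended by zero
   satisfies the same two-term relations at every index, so that no boundary
   case is left. *)
Lemma corresponding_pair_ladder (K : fieldType) (V : vectType K) (d : nat)
    (p : array K) (A As : 'End(V)) :
  corresponding_pair d p A As -> vphi p 0 = 0 -> vphi p d.+1 = 0 ->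
  exists e : nat -> V,
    [/\ forall f g : 'End(V), (forall j, f (e j) = g (e j)) -> f = g,
        forall j, A (e j) = th p j *: e j + e j.+1
      & forall j, As (e j) = ths p j *: e j + vphi p j *: e j.-1].
Proof.
case=> b [b_basis Ab Asb] p0 pd; pose e j := nth 0 b j.
have bE i : tnth b i = e i by exact: tnth_nth.
have e0 j : (d < j)%N -> e j = 0.
  by move=> lt_dj; apply: nth_default; rewrite size_tuple.
exists e; split=> [f g fg | j | j].
- apply/lfunP => x; rewrite (coord_basis b_basis (memvf x)) !linear_sum /=.
  by apply: eq_bigr => i _; rewrite !linearZ /= fg.
- have [le_jd | lt_dj] := leqP j d; last first.
    by rewrite !e0 ?linear0 ?scaler0 ?addr0 // ltnS ltnW.
  have := Ab (Ordinal (le_jd : (j < d.+1)%N)); rewrite bE /= => ->.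
  (* Both terms become sums over the basis, to be compared entry by entry with column [j] of the
     matrix. *)
  rewrite -(sum_kronecker j (th p) e0) -[e j.+1]scale1r.
  rewrite -(sum_kronecker j.+1 (fun=> 1) e0) -big_split /=.
  apply: eq_bigr => i _; rewrite bE mxE -scalerDl -val_eqE /=.
  have [-> | _] := eqVneq (i : nat) j; last by rewrite add0r.
  by rewrite (ltn_eqF (ltnSn j)) addr0.
have [le_jd | lt_dj] := leqP j d; last first.
  rewrite (e0 _ lt_dj) linear0 scaler0 add0r.
  (* Beyond [d], only for index [d.+1] is the preceding vector nonzero; there the coefficient
     [vphi p d.+1] vanishes. *)
  case: j lt_dj => // j; rewrite ltnS leq_eqVlt => /orP[/eqP <- | lt_dj].
    by rewrite pd scale0r.
  by rewrite e0 ?scaler0.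
have := Asb (Ordinal (le_jd : (j < d.+1)%N)); rewrite bE /= => ->.
rewrite -(sum_kronecker j (ths p) e0).
case: j le_jd => [|j] le_jd.
  (* Since [0.-1] is [0], the lowering term is a multiple of [e 0], removed by [vphi p 0 = 0]. *)
  rewrite p0 scale0r addr0; apply: eq_bigr => i _; rewrite bE mxE -val_eqE /=.
  by case: eqP.
rewrite -(sum_kronecker j (fun=> vphi p j.+1) e0) -big_split /=.
apply: eq_bigr => i _; rewrite bE mxE -scalerDl -val_eqE /= eqSS [j == i]eq_sym.
have [-> | _] := eqVneq (i : nat) j.+1; last by rewrite add0r.
by rewrite (gtn_eqF (ltnSn j)) addr0.
Qed.

(* Each hypothesis is the vanishing of one coefficient in the expansion of the
   relations on the split basis.  In [eta] and [etas] the entries of index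
   j - 1 are eliminated by the three-term recurrences. *)
Lemma AW_of_array (K : fieldType) (V : vectType K) (d : nat) (p : array K)
    (beta gam gams rho rhos omega eta etas : K) (A As : 'End(V)) :
  let t := th p in let ts := ths p in let f := vphi p in
  corresponding_pair d p A As -> f 0%N = 0 -> f d.+1 = 0 ->
  (forall j, gam = t j - beta * t j.+1 + t j.+2) ->
  (forall j, gams = ts j - beta * ts j.+1 + ts j.+2) ->
  (forall j, rho = t j ^+ 2 - beta * t j * t j.+1 + t j.+1 ^+ 2
                   - gam * (t j + t j.+1)) ->
  (forall j, rhos = ts j ^+ 2 - beta * ts j * ts j.+1 + ts j.+1 ^+ 2
                    - gams * (ts j + ts j.+1)) ->
  (forall j, omega = (t j + t j.+1) * (ts j + ts j.+1) + f j + f j.+2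
     - beta * (t j * ts j + t j.+1 * ts j.+1 + f j.+1)
     - gam * (ts j + ts j.+1) - gams * (t j + t j.+1)) ->
  (forall j, eta = (2%:R - beta) * t j ^+ 2 * ts j + f j * (t j - t j.+1)
     + f j.+1 * (t j.+1 + t j - beta * t j - gam)
     - 2%:R * gam * t j * ts j - rho * ts j - gams * t j ^+ 2 - omega * t j) ->
  (forall j, etas = (2%:R - beta) * ts j ^+ 2 * t j + f j * (ts j - ts j.+1)
     + f j.+1 * (ts j.+1 + ts j - beta * ts j - gams)
     - 2%:R * gams * ts j * t j - rhos * t j - gam * ts j ^+ 2
     - omega * ts j) ->
  AW beta gam gams rho rhos omega eta etas A As.
Proof.
move=> t ts f /corresponding_pair_ladder pairP f0 fd Hg Hgs Hr Hrs Ho He Hes.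
have{pairP} [e [e_ext Ae Ase]] := pairP f0 fd.
rewrite -/t -/ts -/f in Ae Ase.
have AD x y : A (x + y) = A x + A y by exact: linearD.
have AsD x y : As (x + y) = As x + As y by exact: linearD.
have AZ a x : A (a *: x) = a *: A x by exact: linearZ.
have AsZ a x : As (a *: x) = a *: As x by exact: linearZ.
split; apply: e_ext => j.
all: rewrite !(comp_lfunE, add_lfunE, opp_lfunE, scale_lfunE, id_lfunE).
all: rewrite !(Ae, Ase, AD, AsD, AZ, AsZ).
(* Passing to each coordinate [c] gives identities in [K], where [ring] applies with the values
   [c (e k)] as indeterminates. *)
all: rewrite (coord_vbasis (memvf (_ - _))) [RHS](coord_vbasis (memvf _)).
all: apply: eq_bigr => i _; congr (_ *: _).
all: set c := coord _ i.
all: have cD x y : c (x + y) = c x + c y by exact: linearD.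
all: have cN x : c (- x) = - c x by exact: linearN.
all: have cZ a x : c (a *: x) = a * c x by exact: linearZ.
all: clearbody c t ts f; rewrite !(cD, cN, cZ) {cD cN cZ}.
  (* The scalars are eliminated in an order such that no formula brings back one already
     replaced. *)
  case: j => [|j]; first by rewrite (He 0%N) (Ho 0%N) (Hgs 0%N) f0 /=; ring.
  by rewrite (He j.+1) (Ho j.+1) (Hgs j.+1) (Hr j) (Hg j) /=; ring.
(* [As] occurs twice here and can lower the index by two, so index 1 is also a boundary case. *)
case: j => [|[|j]]; first by rewrite (Hes 0%N) (Hrs 0%N) f0 /=; ring.
  by rewrite (Hes 1%N) (Ho 0%N) (Hrs 1%N) (Hgs 0%N) f0 /=; ring.
by rewrite (Hes j.+2) (Ho j.+1) (Hrs j.+2) (Hgs j.+1) (Hg j) /=; ring.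
Qed.

Theorem lemma7p2 (K : closedFieldType) (char_neq2 : 2%N \notin [pchar K])
    (d : nat) (V : vectType K) (A As : 'End(V)) :
  [/\ (* Racah *)
      forall u us v : K,
        nondegenerate_array d (racah d u us v) ->
        corresponding_pair d (racah d u us v) A As ->
        AW 2%:R 2%:R 2%:R 0 0
           (- 2%:R * u ^+ 2 - 2%:R * us ^+ 2 - 2%:R * v ^+ 2
              - 2%:R * (d%:R + 1) * (u + us + v)
              - 2%:R * d%:R ^+ 2 - 4%:R * d%:R)
           (2%:R * u * (u + d%:R + 1) * (v - us) * (v + us + d%:R + 1))
           (2%:R * us * (us + d%:R + 1) * (v - u) * (v + u + d%:R + 1))
           A As,
      (* Hahn *)
      forall us v : K,
        nondegenerate_array d (hahn d us v) ->
        corresponding_pair d (hahn d us v) A As ->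
        AW 2%:R 0 2%:R 1 0 0
           (- ((us + 1) * (us + d%:R)) - 2%:R * v ^+ 2 - d%:R ^+ 2 / 2%:R)
           (- 4%:R * us * (us + d%:R + 1) * v)
           A As,
      (* dual Hahn *)
      forall u v : K,
        nondegenerate_array d (dual_hahn d u v) ->
        corresponding_pair d (dual_hahn d u v) A As ->
        AW 2%:R 2%:R 0 0 1 0
           (- 4%:R * u * (u + d%:R + 1) * v)
           (- ((u + 1) * (u + d%:R)) - 2%:R * v ^+ 2 - d%:R ^+ 2 / 2%:R)
           A As,
      (* Krawtchouk *)
      forall v : K,
        nondegenerate_array d (krawtchouk d v) ->
        corresponding_pair d (krawtchouk d v) A As ->
        AW 2%:R 0 0 1 1 (2%:R * v - 1) 0 0 A As
    & (* Bannai-Ito *)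
      (~~ odd d ->
       forall u us v : K,
        nondegenerate_array d (bannai_ito_even d u us v) ->
        corresponding_pair d (bannai_ito_even d u us v) A As ->
        AW (- 2%:R) 0 0 1 1
           (4%:R * u * us - 2%:R * (d%:R + 1) * v)
           (2%:R * u * v - (d%:R + 1) * us)
           (2%:R * us * v - (d%:R + 1) * u)
           A As)
      /\
      (odd d ->
       forall u us v : K,
        nondegenerate_array d (bannai_ito_odd d u us v) ->
        corresponding_pair d (bannai_ito_odd d u us v) A As ->
        AW (- 2%:R) 0 0 1 1
           (- 2%:R * u ^+ 2 - 2%:R * us ^+ 2 + 2%:R * v ^+ 2
              + (d%:R + 1) ^+ 2 / 2%:R)
           (- u ^+ 2 + us ^+ 2 - v ^+ 2 + (d%:R + 1) ^+ 2 / 4%:R)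
           (u ^+ 2 - us ^+ 2 - v ^+ 2 + (d%:R + 1) ^+ 2 / 4%:R)
           A As)].
Proof.
have two0 : 2%:R != 0 :> K.
  by apply: contraNneq char_neq2 => two_eq0; rewrite inE /= two_eq0 eqxx.
have four0 : 4%:R != 0 :> K by rewrite (natrM _ 2 2) mulf_neq0.
split=> [u us v|us v|u v|v|].
- by move=> _ pair; apply: (AW_of_array pair) => [||j|j|j|j|j|j|j] /=; ring.
- by move=> _ pair; apply: (AW_of_array pair) => [||j|j|j|j|j|j|j] /=; field.
- by move=> _ pair; apply: (AW_of_array pair) => [||j|j|j|j|j|j|j] /=; field.
- by move=> _ pair; apply: (AW_of_array pair) => [||j|j|j|j|j|j|j] /=; field.
split=> d_parity u us v _ pair; apply: (AW_of_array pair) => [||j|j|j|j|j|j|j] /=.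
(* The parity of [d] selects, at index [d.+1], the branch of [vphi] with the factor [i - d - 1]. *)
all: rewrite ?(negbTE d_parity) ?d_parity /=; try ring.
(* All signs are expressed through [odd j], so that fixing the parity of [j] makes them
   constants. *)
all: rewrite ?negbK ?[(-1) ^+ _.+1]exprS -?[(-1) ^+ j]signr_odd.
all: by case: (odd j) => /=; field; rewrite ?two0 ?four0.
Qed.
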